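(* Let $I$ be a finite subset of $\mathbb{N}\setminus\{0,1\}$ that is $\mathbb{N}$-independent and can be enumerated by a modular-convex sequence $(n_k)_{k\in\{0,\dots,r\}}$ of positive integers such that $n_0$ and $n_1$ are coprime. Denote $(d_i)_{i\in\{1,\dots,r-1\}}$ the sequence of integers such that for all $i\in\{1,\dots,r-1\}$, $d_i\geqslant 2$ and $n_{i+1}=d_in_i-n_{i-1}$. (i) Let $\rho$ be an integer with $\rho>r$, and extend $(d_i)_{i\in\{1,\dots,r-1\}}$ by arbitrary integers $d_r,\dots,d_{\rho-1}$, all at least $2$. Let $d$ and $m$ be the coprime positive integers such that $\frac{d}{m}=\lceil d_1,d_2,\dots,d_{\rho-1}\rceil$, and for $i\in\{1,\dots,\rho-1\}$ let $\frac{q_i}{p_i}$ be the reduced fraction of $\lceil d_1,\dots,d_i\rceil$ (equivalently $q_{-1}=0$, $q_0=1$, $q_i=d_iq_{i-1}-q_{i-2}$). Put $a=n_0$ and $b=dn_1-mn_0$. Then $$\begin{cases}\gcd(a,b)=1\\ a\leqslant q_r\\ d<b\end{cases}\ \Longrightarrow\ \begin{cases} a<d<b\\ \mathrm{Irr}\left(\frac{\langle a,b\rangle}{d}\right)=I.\end{cases}$$ (ii) All triplets $(a,b,d)$ of pairwise coprime positive integers such that $\mathrm{Irr}\left(\frac{\langle a,b\rangle}{d}\right)=I$ and $a<d<b$ are obtained as in (i). (iii) There are infinitely many triplets $(a,b,d)$ of pairwise coprime positive integers such that $\mathrm{Irr}\left(\frac{\langle a,b\rangle}{d}\right)=I$,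 $a<d<b$, obtained as in (i) with $\rho=r+1$.
   Context: For coprime positive integers $a,b$, $\langle a,b\rangle$ is the numerical semigroup $\{xa+yb: x,y\in\mathbb{N}\}$, and for a positive integer $d$, $\frac{\langle a,b\rangle}{d}=\{x\in\mathbb{N}: dx\in\langle a,b\rangle\}$. $\mathrm{Irr}(S)$ denotes the set of irreducible elements (minimal generators) of a numerical semigroup $S$. A set $A\subset\mathbb{N}$ is $\mathbb{N}$-independent if no $x\in A$ belongs to the submonoid generated by $A\setminus\{x\}$. A sequence $(u_i)$ is modular-convex if for every interior index $i$ there is an integer $c_i\geqslant 0$ with $u_{i-1}+u_{i+1}-2u_i=c_iu_i$. The ceiling continued fraction is defined recursively by $\lceil d_0\rceil=d_0$ and $\lceil d_0,d_1,\dots,d_i\rceil=d_0-\frac{1}{\lceil d_1,\dots,d_i\rceil}$.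
   Formalization: In (ii), ''obtained as in (i)'' is read as obtained from some modular-convex enumeration of I with coprime first two terms, not necessarily the given one; with (n_k) fixed it fails, e.g. I={2,3}, (n_0,n_1)=(2,3), triplet (a,b,d)=(3,5,4). *)

(* Defs.v *)
From mathcomp Require Export all_boot all_order all_algebra.
From mathcomp Require Export boolp classical_sets functions cardinality.
Set Implicit Arguments.
Unset Strict Implicit.
Unset Printing Implicit Defensive.
Export Order.TTheory GRing.Theory Num.Theory.

#[global] Open Scope classical_set_scope.
#[global] Open Scope ring_scope.
#[global] Open Scope nat_scope.

Definition submonoid (M : set nat) : Prop :=
  M 0 /\ forall x y, M x -> M y -> M (x + y).

Definition N_independent (A : set nat) : Prop :=
  forall x, A x -> ~ smallest submonoid (A `\ x) x.

Definition gen2 (a b : nat) : set nat :=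
  [set z | exists x y, z = x * a + y * b].

Definition quotient_by (S : set nat) (d : nat) : set nat :=
  [set x | S (d * x)].

Definition Irr (S : set nat) : set nat :=
  [set x | [/\ S x, x <> 0 &
    forall y z, S y -> S z -> x = y + z -> y = 0 \/ z = 0]].

(* A sequence indexed by {0, ..., r} is a function on nat whose values beyond
   r are irrelevant. *)
Definition modular_convex (r : nat) (u : nat -> nat) : Prop :=
  forall i, 0 < i < r ->
    exists2 c : int, (0 <= c)%R &
      ((u i.-1)%:Z + (u i.+1)%:Z - 2%:Z * (u i)%:Z = c * (u i)%:Z)%R.

Definition mc_enumeration (I : set nat) (r : nat) (n : nat -> nat) : Prop :=
  [/\ 0 < r,
      set_bij [set k | k <= r] I n,
      forall k, k <= r -> 0 < n k,
      modular_convex r n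
    & coprime (n 0) (n 1)].

(* The value on the empty sequence is junk. *)
Fixpoint ceilfrac (s : seq int) : rat :=
  match s with
  | [::] => 0%R
  | [:: x] => (x%:~R)%R
  | x :: s' => (x%:~R - (ceilfrac s')^-1)%R
  end.

(* The ceiling continued fraction of delta 1, ..., delta i. *)
Definition ceilfrac_upto (delta : nat -> int) (i : nat) : rat :=
  ceilfrac [seq delta j | j <- iota 1 i].

(* The numerator q_i of the reduced fraction q_i / p_i. *)
Definition qnum (delta : nat -> int) (i : nat) : int :=
  numq (ceilfrac_upto delta i).

(* delta carries both the d_i determined by n (0 < i < r) and the arbitrary
   ones extending them (r <= i < rho). A negative d n_1 - m n_0 is not
   represented by any b : nat; this is harmless as only b > d is considered. *)
Definition construction (r : nat) (n : nat -> nat) (rho : nat)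
    (delta : nat -> int) (m a b d : nat) : Prop :=
  [/\ r < rho,
      forall i, 0 < i < r ->
        (2 <= delta i)%R /\
        ((n i.+1)%:Z = delta i * (n i)%:Z - (n i.-1)%:Z)%R,
      forall i, r <= i < rho -> (2 <= delta i)%R,
      [/\ 0 < d, 0 < m, coprime d m
        & (d%:R / m%:R = ceilfrac_upto delta rho.-1)%R]
    & a = n 0 /\ (b%:Z = d%:Z * (n 1%N)%:Z - m%:Z * (n 0%N)%:Z)%R].

Definition admissible (r : nat) (delta : nat -> int) (a b d : nat) : Prop :=
  [/\ coprime a b, (a%:Z <= qnum delta r)%R & d < b].

(* For given I these triplets come from all the modular-convex enumerations of
   I, not from a single one (nor from one and its reverse): 3, 5, 7 and 5, 3, 7
   both enumerate {3, 5, 7}, and (a, b, d) = (5, 11, 7) arises only from the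
   latter, as a is the first term. *)
Definition triplet_for (I : set nat) (a b d : nat) : Prop :=
  [/\ [/\ 0 < a, 0 < b & 0 < d],
      [/\ coprime a b, coprime a d & coprime b d],
      Irr (quotient_by (gen2 a b) d) = I
    & a < d < b].

(* Main.v *)
Require Import Defs.
From mathcomp Require Import zify ring.

Set Implicit Arguments.
Unset Strict Implicit.
Unset Printing Implicit Defensive.

(** The quotient <a, b> / d is the image, under (u, v) |-> (u a + v b) / d, of the
    monoid of all (u, v) >= 0 with u a + v b divisible by d, that is, with
    u = m v modulo d. The Hilbert basis of this monoid is given by the
    Hirzebruch-Jung expansion of d / m: it consists of vectors (u_k, q_(k-1)),
    0 <= k <= rho, any two consecutive ones forming a basis of the lattice, and
    it satisfies the same recurrence as (n_k), so that the k-th vector is mapped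
    to n_k. As (u, v) and (u + b, v - a) have the same image, only vectors with
    q_(k-1) < a are needed to generate the quotient; as d < b, these have a
    unique preimage, hence are mapped to irreducible elements. For infinitely
    many triplets, let d_r vary in a suitable residue class modulo n_0. *)

(** * Numerators and denominators of ceiling continued fractions *)

Section CeilingFractions.
Local Open Scope ring_scope.
Implicit Types (delta : nat -> int) (x : nat -> int).

Definition ge2_upto delta (N : nat) := forall i, (0 < i < N)%N -> 2 <= delta i.

Definition hj_rec delta (N : nat) x :=
  forall k, (k.+1 < N)%N -> x k.+2 = delta k.+1 * x k.+1 - x k.

Fixpoint hj_pair delta (x0 x1 : int) (k : nat) : int * int :=
  if k is j.+1 then
    let: (y, z) := hj_pair delta x0 x1 j in (z, delta j.+1 * z - y)
  else (x0, x1).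

(* [qseq delta k] and [pseq delta k] are the paper's q_(k-1) and p_(k-1). *)
Definition qseq delta k := (hj_pair delta 0 1 k).1.
Definition pseq delta k := (hj_pair delta (-1) 0 k).1.

Lemma qseqSS delta k : qseq delta k.+2 = delta k.+1 * qseq delta k.+1 - qseq delta k.
Proof. by rewrite /qseq /=; case: hj_pair. Qed.

Lemma pseqSS delta k : pseq delta k.+2 = delta k.+1 * pseq delta k.+1 - pseq delta k.
Proof. by rewrite /pseq /=; case: hj_pair. Qed.

(** [qseq] and [pseq] start with [0, 1] and [-1, 0], so they span all solutions of the
    recurrence. *)
Lemma hj_rec_solution delta N x k : hj_rec delta N x -> (k <= N)%N ->
  x k = x 1%N * qseq delta k - x 0%N * pseq delta k.
Proof.
move=> xrec; elim/ltn_ind: k => -[|[|k]] IH kN.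
- by rewrite /qseq /pseq /=; ring.
- by rewrite /qseq /pseq /=; ring.
- by rewrite qseqSS pseqSS xrec // (IH k.+1) ?(ltnW kN) // (IH k) ?(ltnW (ltnW kN)) //; ring.
Qed.

(** The recurrence preserves this determinant, because its coefficient of the older term is [-1]. It
    makes the fractions [qseq / pseq] reduced and consecutive lattice vectors a basis. *)
Lemma casoratian delta k :
  pseq delta k.+1 * qseq delta k - pseq delta k * qseq delta k.+1 = 1.
Proof.
elim: k => [|k <-]; first by rewrite /qseq /pseq /=; ring.
by rewrite qseqSS pseqSS; ring.
Qed.

Lemma eq_hj delta delta' N : (forall i, (0 < i < N)%N -> delta i = delta' i) ->
  forall k, (k <= N)%N -> qseq delta k = qseq delta' k /\ pseq delta k = pseq delta' k.
Proof.
move=> eqd k; elim/ltn_ind: k => -[|[|k]] IH kN //.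
have [? ?] := IH k.+1 (leqnn _) (ltnW kN).
have [? ?] := IH k (leqnSn _) (ltnW (ltnW kN)).
by rewrite !qseqSS !pseqSS eqd //; split; congr (_ * _ - _).
Qed.

Lemma qseq_incr delta N k : ge2_upto delta N -> (k < N)%N ->
  0 <= qseq delta k < qseq delta k.+1.
Proof.
move=> ge2; elim: k => [|k IH] kN; first by [].
have := IH (ltnW kN); have := ge2 k.+1 kN; rewrite qseqSS; nia.
Qed.

Lemma qseq_gt0 delta N k : ge2_upto delta N -> (k < N)%N -> 0 < qseq delta k.+1.
Proof. by move=> ge2 kN; have := qseq_incr ge2 kN; lia. Qed.

Lemma qseq_mono delta N j k : ge2_upto delta N -> (j <= k <= N)%N ->
  qseq delta j <= qseq delta k.
Proof.
move=> ge2; elim: k => [|k IH] /andP[jk kN]; first by have -> : j = 0%N by lia.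
move: jk; rewrite leq_eqVlt => /orP[/eqP->//|jk].
have := IH _; have := qseq_incr ge2 kN; lia.
Qed.

Lemma qseq_ltn delta N j k : ge2_upto delta N -> (j < k <= N)%N ->
  qseq delta j < qseq delta k.
Proof.
move=> ge2 /andP[jk kN]; have := qseq_incr ge2 (leq_trans jk kN).
have := @qseq_mono _ _ j.+1 k ge2; lia.
Qed.

Definition shift delta i := delta i.+1.

(** The recurrence appends coefficients at the end, whereas [ceilfrac] unfolds from the front; here
    the first coefficient is peeled off. *)
Lemma hj_shift delta k :
  qseq delta k.+1 = delta 1%N * qseq (shift delta) k - pseq (shift delta) k
  /\ pseq delta k.+1 = qseq (shift delta) k.
Proof.
elim/ltn_ind: k => -[|[|k]] IH.
- by rewrite /qseq /pseq /=; split; ring.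
- by rewrite /qseq /pseq /=; split; ring.
- have [q1 p1] := IH k.+1 (leqnn _); have [q0 p0] := IH k (leqnSn _).
  rewrite !(qseqSS _ k.+1) !(pseqSS _ k.+1) q1 p1 q0 p0.
  by rewrite (qseqSS _ k) (pseqSS _ k) /shift; split; ring.
Qed.

Lemma ge2_shift delta N : ge2_upto delta N.+1 -> ge2_upto (shift delta) N.
Proof. by move=> ge2 i /andP[i0 iN]; apply: ge2; lia. Qed.

Lemma pseq_gt0 delta i : ge2_upto delta i.+2 -> 0 < pseq delta i.+2.
Proof.
move=> /ge2_shift ge2; have [_ ->] := hj_shift delta i.+1.
exact: (qseq_gt0 ge2).
Qed.

Lemma ceilfrac_shift delta i :
  ceilfrac_upto delta i.+2 = (delta 1%N)%:~R - (ceilfrac_upto (shift delta) i.+1)^-1.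
Proof.
rewrite /ceilfrac_upto /= -[in LHS](addn1 2) iotaDl -map_comp /=.
by congr (_ - (ceilfrac (_ :: _))^-1); rewrite -[in RHS](addn1 1) iotaDl -map_comp.
Qed.

Lemma ceilfrac_hj delta i : ge2_upto delta i.+2 ->
  ceilfrac_upto delta i.+1 = (qseq delta i.+2)%:~R / (pseq delta i.+2)%:~R.
Proof.
elim: i delta => [|i IH] delta ge2.
  by rewrite /ceilfrac_upto /qseq /pseq /= mulr1 subr0 mulr0 add0r opprK divr1.
rewrite ceilfrac_shift IH; last exact: ge2_shift.
have [-> ->] := hj_shift delta i.+2.
have := qseq_gt0 (ge2_shift ge2) (leqnn _).
rewrite -(ltr0z rat) => /lt0r_neq0 q0.
rewrite invf_div intrB intrM mulrBl mulfK //.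
Qed.

Lemma coprime_hj delta k : coprime `|qseq delta k| `|pseq delta k|.
Proof.
rewrite -coprimezE; apply/coprimezP.
by exists (pseq delta k.+1, - qseq delta k.+1); rewrite -(casoratian delta k) /=; ring.
Qed.

Lemma qnum_hj delta i : ge2_upto delta i.+2 -> qnum delta i.+1 = qseq delta i.+2.
Proof.
move=> ge2; rewrite /qnum ceilfrac_hj // coprimeq_num ?coprime_hj //.
by rewrite gtr0_sg ?pseq_gt0 // mul1r.
Qed.

Lemma ceilfrac_hjP delta i (d m : nat) : ge2_upto delta i.+2 -> (0 < m)%N -> coprime d m ->
  (d%:R / m%:R = ceilfrac_upto delta i.+1)%R <->
  (d%:Z = qseq delta i.+2 /\ m%:Z = pseq delta i.+2).
Proof.
move=> ge2 m0 dm; rewrite ceilfrac_hj //; split; last by move=> [<- <-].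
have p0 := pseq_gt0 ge2.
rewrite -[d%:R]/(d%:Z%:~R) -[m%:R]/(m%:Z%:~R) => E.
have := congr1 numq E; have := congr1 denq E.
rewrite !coprimeq_num ?coprimeq_den ?coprime_hj // gtr0_sg // mul1r.
rewrite (gtr0_sg p0) mul1r (negPf (lt0r_neq0 p0)) -[m%:Z == 0]/(m == 0%N) eqn0Ngt m0 /=.
by move=> pE qE; split=> //; lia.
Qed.

End CeilingFractions.

(** * The lattice of pairs [(u, v)] and its Hilbert basis *)

Section Lattice.
Local Open Scope ring_scope.
Implicit Types (delta : nat -> int).

(** First coordinates of the Hilbert basis: for [rho > 0], the solution of the recurrence with value
    1 at [rho - 1] and 0 at [rho]. This form shows the congruence with
    [pseq delta rho * qseq delta k] modulo [qseq delta rho]. *)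
Definition useq delta (rho k : nat) : int :=
  pseq delta rho * qseq delta k - pseq delta k * qseq delta rho.

Lemma useq_rec delta rho N : hj_rec delta N (useq delta rho).
Proof. by move=> k kN; rewrite /useq qseqSS pseqSS; ring. Qed.

Lemma useq0 delta rho : useq delta rho 0 = qseq delta rho.
Proof. by rewrite /useq /qseq /pseq /=; ring. Qed.

Lemma useq_top delta rho : useq delta rho rho = 0.
Proof. by rewrite /useq; ring. Qed.

(** Mirror image of [qseq_incr]: the recurrence is run downwards from the final values 1 and 0. *)
Lemma useq_decr delta rho k : ge2_upto delta rho -> (k < rho)%N ->
  0 <= useq delta rho k.+1 < useq delta rho k.
Proof.
move=> ge2; move eqj: (rho - k)%N => j.
elim: j k eqj => [|[|j] IH] k eqj kr; first by lia.
  have -> : rho = k.+1 by lia.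
  by rewrite useq_top /useq casoratian.
have := IH k.+1; rewrite (@useq_rec _ _ k.+2) //.
have := ge2 k.+1; nia.
Qed.

Lemma useq_ge0 delta rho k : ge2_upto delta rho -> (k <= rho)%N -> 0 <= useq delta rho k.
Proof.
move=> ge2; rewrite leq_eqVlt => /orP[/eqP->|kr]; first by rewrite useq_top.
by have := useq_decr ge2 kr; lia.
Qed.

Lemma useq_anti delta rho j k : ge2_upto delta rho -> (j < k <= rho)%N ->
  useq delta rho k < useq delta rho j.
Proof.
move=> ge2; elim: k => [//|k IH] /andP[]; rewrite ltnS leq_eqVlt.
move=> /orP[/eqP-> kr|jk kr]; first by have := useq_decr ge2 kr; lia.
by have := useq_decr ge2 kr; have := IH _; lia.
Qed.

(* The vectors (useq k, qseq k) are the Hilbert basis of the monoid of all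
   (u, v) >= 0 with u = p_rho v modulo q_rho: two consecutive ones form a basis
   of the lattice, and (u, v) has coordinates (alpha, beta) in the basis of
   indices k, k + 1 such that qseq k <= v < qseq (k + 1). *)
Lemma lattice_step delta rho (u v t : int) :
  ge2_upto delta rho -> 0 <= u -> 0 <= v -> 0 < u + v ->
  u = pseq delta rho * v - t * qseq delta rho ->
  exists2 k, (k <= rho)%N &
    [/\ useq delta rho k <= u, qseq delta k <= v & (k < rho)%N -> v < qseq delta k.+1].
Proof.
move=> ge2 u0 v0 uv uE.
have [k kr [kv vk]] : exists2 k, (k <= rho)%N &
    qseq delta k <= v /\ ((k < rho)%N -> v < qseq delta k.+1).
  elim: rho {ge2 uE} => [|rho [k kr [kv vk]]]; first by exists 0%N.
  have [|kr'] := ltnP k rho.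
    by move=> kr'; exists k; [lia|split=> // _; exact: vk].
  have ek : k = rho by lia.
  have [|] := ltP v (qseq delta rho.+1); last by exists rho.+1 => //; split => //; lia.
  by move=> vr; exists k; [lia|split=> // _; rewrite ek].
exists k => //; split=> //.
move: kr; rewrite leq_eqVlt => /orP[/eqP->|kr]; first by rewrite useq_top.
have {}vk := vk kr; have det := casoratian delta k.
pose alpha := v * pseq delta k.+1 - t * qseq delta k.+1.
pose beta := t * qseq delta k - v * pseq delta k.
have vE : v = alpha * qseq delta k + beta * qseq delta k.+1.
  by rewrite -[LHS]mulr1 -det /alpha /beta; ring.
have {}uE : u = alpha * useq delta rho k + beta * useq delta rho k.+1.
  have tE : t = alpha * pseq delta k + beta * pseq delta k.+1.
    by rewrite -[LHS]mulr1 -det /alpha /beta; ring.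
  by rewrite uE {1}vE {1}tE /useq; ring.
have := useq_decr ge2 kr; have := qseq_incr ge2 kr.
move: uE vE kv vk u0 v0 uv.
move: (useq _ _ k) (useq _ _ k.+1) (qseq _ k) (qseq _ k.+1) alpha beta.
move=> {t det ge2 kr} x x' y y' al be -> ->.
move=> yv vy u0 v0 uv ? ?; rewrite leNgt; apply/negP => ux.
(* Here [u = (al + be) x - be (x - x')] and [v = (al + be) y + be (y' - y)]. If [be >= 1], then
   [al + be <= 0] gives [u < 0], and [al + be >= 1] gives [v >= y']. If [be <= 0], then
   [al + be >= 1] gives [u >= x]; otherwise [v < 0], or [be = 0] and [u + v <= 0]. *)
have [b1|b0] := leP 1 be.
  have [ab|ab] := leP be (- al).
    have : (- al - be) * x >= 0 by apply: mulr_ge0; lia.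
    have : be * (x - x') > 0 by apply: mulr_gt0; lia.
    lia.
  have : (al + be - 1) * y >= 0 by apply: mulr_ge0; lia.
  have : (be - 1) * (y' - y) >= 0 by apply: mulr_ge0; lia.
  lia.
have [ab|ab] := leP (1 - be) al.
  have : (al + be - 1) * x >= 0 by apply: mulr_ge0; lia.
  have : (- be) * (x - x') >= 0 by apply: mulr_ge0; lia.
  lia.
have : (- al - be) * y >= 0 by apply: mulr_ge0; lia.
have [be0|be0] := leP 0 be.
  have be_eq0 : be = 0 by lia.
  have : (- al) * y >= 0 by apply: mulr_ge0; lia.
  move: u0 v0 uv; rewrite be_eq0 !mul0r !addr0.
  have : (- al) * x >= 0 by apply: mulr_ge0; lia.
  lia.
have : (- be) * (y' - y) > 0 by apply: mulr_gt0; lia.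
lia.
Qed.

End Lattice.

(** * Generators and irreducible elements of the quotient *)

Section Quotient.
Local Open Scope ring_scope.
Implicit Types (delta : nat -> int) (n : nat -> nat).

(* The linear form (u, v) |-> (u a + v b) / d maps the Hilbert basis vectors of
   indices 0, ..., R to n 0, ..., n R. *)
Definition hj_quotient delta (rho R a b d : nat) n : Prop :=
  [/\ ge2_upto delta rho, d%:Z = qseq delta rho, coprime a d,
      exists s : int, pseq delta rho * a%:Z + b%:Z = s * d%:Z
    & (R < rho)%N /\ forall k, (k <= R)%N ->
        d%:Z * (n k)%:Z = useq delta rho k * a%:Z + qseq delta k * b%:Z].

Lemma hj_quotient_gt0 delta rho R a b d n :
  hj_quotient delta rho R a b d n -> (0 < d)%N.
Proof.
move=> [ge2 dE _ _ [Rr _]].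
by have := @qseq_gt0 _ _ rho.-1 ge2; rewrite prednK; lia.
Qed.

Lemma hj_quotient_mem delta rho R a b d n k :
  hj_quotient delta rho R a b d n -> (k <= R)%N -> quotient_by (gen2 a b) d (n k).
Proof.
move=> [ge2 _ _ _ [Rr nE]] kR; exists `|useq delta rho k|%N, `|qseq delta k|%N.
have := nE k kR; have := @useq_ge0 _ _ k ge2; have := @qseq_incr _ _ k ge2; lia.
Qed.

(** Multiplied by [a], which is invertible modulo [d], the difference [pseq delta rho * v - u]
    becomes [d (s v - x)]. *)
Lemma hj_quotient_lattice delta rho R a b d n (u v x : nat) :
  hj_quotient delta rho R a b d n -> (d * x = u * a + v * b)%N ->
  exists t : int, u%:Z = pseq delta rho * v%:Z - t * qseq delta rho.
Proof.
move=> [_ dE cad [s sE] _] xE.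
have /dvdzP[t tE] : (d%:Z %| pseq delta rho * v%:Z - u%:Z)%Z.
  rewrite -(@Gauss_dvdzl _ _ a%:Z); last by rewrite coprimezE /= coprime_sym.
  apply/dvdzP; exists (s * v%:Z - x%:Z).
  have {}xE : d%:Z * x%:Z = u%:Z * a%:Z + v%:Z * b%:Z by lia.
  transitivity (v%:Z * (s * d%:Z) - d%:Z * x%:Z); last by ring.
  by rewrite -sE xE; ring.
by exists t; rewrite -dE -tE; ring.
Qed.

(* If v >= a, then (u, v) may be replaced by (u + b, v - a), which represents
   the same element of the quotient. *)
Lemma hj_quotient_step delta rho R a b d n x :
  hj_quotient delta rho R a b d n -> (0 < a)%N -> a%:Z <= qseq delta R.+1 ->
  quotient_by (gen2 a b) d x -> x <> 0%N ->
  exists2 k, (k <= R)%N &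
    exists2 y, quotient_by (gen2 a b) d y & x = (n k + y)%N.
Proof.
move=> H a0 aq [u0 [v0 x0E]] x0; have d0 := hj_quotient_gt0 H.
have [u [v [xE va]]] : exists u v, (d * x = u * a + v * b)%N /\ (v < a)%N.
  exists (u0 + v0 %/ a * b)%N, (v0 %% a)%N; split; last by rewrite ltn_mod.
  by rewrite x0E {1}(divn_eq v0 a); ring.
have [t tE] := hj_quotient_lattice H xE.
case: H => ge2 dE cad [s sE] [Rr nE].
have uv : 0 < u%:Z + v%:Z.
  have [//|uv0] := ltP 0 (u%:Z + v%:Z).
  have [uz vz] : u = 0%N /\ v = 0%N by lia.
  by move: xE; rewrite uz vz; nia.
have [//|//|k kr [ku kv vk]] := lattice_step ge2 _ _ uv tE.
have kR : (k <= R)%N.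
  have [//|Rk] := leqP k R.
  by have := @qseq_mono _ _ R.+1 k ge2; lia.
exists k => //; have nk := nE k kR.
have uk0 := @useq_ge0 _ _ k ge2 kr.
have qk0 : 0 <= qseq delta k by have := @qseq_incr _ _ k ge2; lia.
have nx : (n k <= x)%N.
  rewrite -(leq_pmul2l d0) -lez_nat PoszM nk xE PoszD !PoszM.
  by apply: lerD; apply: ler_wpM2r.
exists (x - n k)%N; last by rewrite subnKC.
exists `|u%:Z - useq delta rho k|%N, `|v%:Z - qseq delta k|%N.
apply/eqP; rewrite -eqz_nat; apply/eqP.
rewrite PoszD !PoszM -subzn // !gez0_abs ?subr_ge0 //.
rewrite mulrBr nk -PoszM xE PoszD !PoszM; ring.
Qed.

(* The representations of n k are the (u_k + t b, v_k - t a), and t = 0 is the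
   only one for which both entries are nonnegative. *)
Lemma hj_quotient_unique delta rho R a b d n k (u v : nat) :
  hj_quotient delta rho R a b d n -> coprime a b -> (d < b)%N ->
  (k <= R)%N -> qseq delta k < a%:Z -> (d * n k = u * a + v * b)%N ->
  u%:Z = useq delta rho k /\ v%:Z = qseq delta k.
Proof.
move=> H cab db kR qa nk; case: H => ge2 dE _ _ [Rr nE].
have uk0 := @useq_ge0 _ _ k ge2 (ltnW (leq_ltn_trans kR Rr)).
have qk0 : 0 <= qseq delta k by have := @qseq_incr _ _ k ge2; lia.
have ukd : useq delta rho k <= d%:Z.
  rewrite dE -(useq0 delta); case: k kR {nk qa uk0 qk0} => // k kR.
  by apply/ltW/useq_anti => //; lia.
have nk' : u%:Z * a%:Z + v%:Z * b%:Z = useq delta rho k * a%:Z + qseq delta k * b%:Z.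
  by rewrite -nE // -!PoszM nk PoszD.
have /dvdzP[t tE] : (a%:Z %| qseq delta k - v%:Z)%Z.
  rewrite -(@Gauss_dvdzl _ _ b%:Z) ?coprimezE //.
  by apply/dvdzP; exists (u%:Z - useq delta rho k); lia.
have a0 : (0 < a)%N by lia.
(* [t < 0] would give [u <= d - b < 0], and [t > 0] would give [v <= qseq delta k - a < 0]. *)
have t0 : t = 0.
  have tu : u%:Z - useq delta rho k = t * b%:Z.
    apply: (mulIf (x := a%:Z)); first by lia.
    rewrite mulrAC -tE; lia.
  have [t1|t1|//] := ltgtP t 0.
    have : (- t - 1) * b%:Z >= 0 by apply: mulr_ge0; lia.
    lia.
  have : (t - 1) * a%:Z >= 0 by apply: mulr_ge0; lia.
  lia.
have vE : v%:Z = qseq delta k by lia.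
split=> //; apply: (mulIf (x := a%:Z)); first by lia.
by move: nk'; rewrite vE; lia.
Qed.

Lemma hj_quotient_gen_gt0 delta rho R a b d n k :
  hj_quotient delta rho R a b d n -> (0 < a)%N -> (0 < b)%N -> (k <= R)%N -> (0 < n k)%N.
Proof.
move=> [ge2 dE _ _ [Rr nE]] a0 b0 kR; have := nE k kR.
have := @useq_decr _ _ k ge2; have := @qseq_incr _ _ k ge2; nia.
Qed.

(** By uniqueness, a splitting of [n k] lifts to one of the vector [(useq k, qseq k)]. Each nonzero
    part has second entry at least [qseq delta k], which is impossible for two parts when
    [k > 0]. *)
Lemma hj_quotient_irr delta rho R a b d n k :
  hj_quotient delta rho R a b d n -> coprime a b -> (d < b)%N ->
  (k <= R)%N -> qseq delta k < a%:Z -> Irr (quotient_by (gen2 a b) d) (n k).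
Proof.
move=> H cab db kR qa; have d0 := hj_quotient_gt0 H.
have [ge2 dE cad [s sE] [Rr nE]] := H.
have qk0 : 0 <= qseq delta k by have := @qseq_incr _ _ k ge2; lia.
split; first exact: (hj_quotient_mem H).
  by apply/eqP; rewrite -lt0n; apply: (hj_quotient_gen_gt0 H) => //; lia.
move=> y z [u [v yE]] [u' [v' zE]] nyz.
have [uE vE] : (u + u')%N%:Z = useq delta rho k /\ (v + v')%N%:Z = qseq delta k.
  by apply: (hj_quotient_unique H) => //; rewrite nyz mulnDr yE zE; ring.
(* A nonzero summand of (u_k, v_k) dominates some (u_j, v_j), and u_j <= u_k
   forces j >= k, hence it has second entry v_k. *)
have top (w w' x : nat) : (d * x = w * a + w' * b)%N -> x <> 0%N ->
    w%:Z <= useq delta rho k -> w' = `|qseq delta k|%N \/ qseq delta k < w'%:Z.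
  move=> xE x0 wk; have [t tE] := hj_quotient_lattice H xE.
  have ww : 0 < w%:Z + w'%:Z.
    have [//|ww0] := ltP 0 (w%:Z + w'%:Z).
    have [wz wz'] : w = 0%N /\ w' = 0%N by lia.
    by move: xE; rewrite wz wz'; nia.
  have [//|//|j jr [ju jv vj]] := lattice_step ge2 _ _ ww tE.
  have kj : (k <= j)%N.
    have [//|jk] := leqP k j.
    by have := @useq_anti _ _ j k ge2; lia.
  have := @qseq_mono _ _ k j ge2; lia.
have [->|/eqP y0] := eqVneq y 0%N; first by left.
have [->|/eqP z0] := eqVneq z 0%N; first by right.
have := top _ _ _ yE y0 _; have := top _ _ _ zE z0 _ => hz hy.
have {}hz := hz _; have {}hy := hy _.
case: k kR qa qk0 uE vE hz hy {nyz top} => [|k] kR qa qk0 uE vE hz hy; last first.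
  have := @qseq_gt0 _ _ k ge2; lia.
(* For [k = 0] both second entries vanish, so [d] divides both first entries; as these add up to
   [d], one of them is zero. *)
move: uE vE; rewrite useq0 -dE /qseq /= => uE vE.
have [vz vz'] : v = 0%N /\ v' = 0%N by lia.
have dvdu (w x : nat) : (d * x = w * a + 0 * b)%N -> (d %| w)%N.
  move=> xE; rewrite -(@Gauss_dvdl _ _ a) 1?coprime_sym //.
  by apply/dvdnP; exists x; lia.
rewrite vz in yE; rewrite vz' in zE.
have /dvdnP[i iE] := dvdu _ _ yE; have /dvdnP[i' iE'] := dvdu _ _ zE.
rewrite iE in yE uE; rewrite iE' in zE uE.
have : (i + i' = 1)%N by nia.
by case: i yE {iE uE} => [|i] yE; [left|right]; nia.
Qed.

End Quotient.

(** * Admissible constructions have [I] as irreducible elements *)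

(** Splitting off elements of [I] repeatedly writes any element of [S] below [g] as a sum of
    elements of [I] other than [g]. So a proper splitting of [g] in [S] would contradict
    independence. *)
Lemma Irr_of_independent (S I : set nat) :
  I `<=` S -> ~ I 0 -> N_independent I ->
  (forall x, S x -> x <> 0 -> exists2 g, I g & exists2 y, S y & x = g + y) ->
  Irr S = I.
Proof.
move=> IS I0 indep step.
have below g y : S y -> y < g -> smallest submonoid (I `\ g) y.
  elim/ltn_ind: y => y IH Sy yg M HM; have [[M0 MD] IM] := HM.
  have [->//|/eqP y0] := eqVneq y 0.
  have [h Ih [z Sz yE]] := step y Sy y0.
  have h0 : h <> 0 by move=> h0; apply: I0; rewrite -h0.
  rewrite yE; apply: MD; first by apply: IM; split=> //= hg; lia.
  by apply: (IH z _ Sz _ M HM); lia.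
apply/seteqP; split=> [x [Sx x0 xirr]|g Ig].
  have [h Ih [y Sy xE]] := step x Sx x0.
  case: (xirr h y (IS h Ih) Sy xE) => h0; first by rewrite h0 in Ih.
  by rewrite xE h0 addn0.
split; first exact: IS.
  by move=> g0; rewrite g0 in Ig.
move=> y z Sy Sz gE.
have [->|y0] := eqVneq y 0; first by left.
have [->|z0] := eqVneq z 0; first by right.
case: (indep g Ig) => M HM; have [[M0 MD] IM] := HM.
by rewrite gE; apply: MD; [apply: (below g y Sy _ M HM)|apply: (below g z Sz _ M HM)]; lia.
Qed.

Lemma construction_ge2 r n rho delta m a b d :
  construction r n rho delta m a b d -> ge2_upto delta rho.
Proof.
move=> [rrho dn dr _ _] i /andP[i0 ir].
have [ir'|ir'] := ltnP i r; first by have [|] := dn i; lia.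
by apply: dr; lia.
Qed.

Lemma construction_rec r n rho delta m a b d :
  construction r n rho delta m a b d -> hj_rec delta r (fun k => (n k)%:Z).
Proof. by move=> [_ dn _ _ _] k kr; have [] := dn k.+1 kr. Qed.

Lemma construction_hj r n rho delta m a b d : 0 < r ->
  construction r n rho delta m a b d ->
  d%:Z = qseq delta rho /\ m%:Z = pseq delta rho.
Proof.
move=> r0 C; have ge2 := construction_ge2 C.
case: C => rrho _ _ [d0 m0 cdm cf] _.
case: rho rrho ge2 cf => [|[|i]] rrho ge2 cf; try by lia.
exact/ceilfrac_hjP.
Qed.

Lemma coprime_Bezout (x y : nat) :
  coprime x y <-> exists u v : int, (u * x%:Z + v * y%:Z = 1)%R.
Proof.
rewrite -[coprime x y]/(coprimez x y); split=> [/coprimezP[[u v] /= E]|[u [v E]]].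
  by exists u, v.
by apply/coprimezP; exists (u, v).
Qed.

(** A common divisor of [a] and [d] divides [b = d n_1 - m n_0]; and modulo [d], [b] is [- m n_0], a
    product of units. *)
Lemma construction_coprime r n rho delta m a b d :
  construction r n rho delta m a b d -> coprime a b -> coprime a d /\ coprime b d.
Proof.
move=> [_ _ _ [d0 _ cdm _] [-> bE]] /coprime_Bezout[u [v uv]].
have cad : coprime (n 0) d.
  apply/coprime_Bezout; exists (u - v * m%:Z)%R, (v * (n 1)%:Z)%R.
  by rewrite -uv bE; ring.
split=> //; have : coprime d (m * n 0) by rewrite coprimeMr cdm coprime_sym.
move=> /coprime_Bezout[x [y xy]]; apply/coprime_Bezout.
by exists (- y)%R, (x + y * (n 1)%:Z)%R; rewrite -xy bE PoszM; ring.
Qed.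

(** Inserting [b = d n_1 - m n_0] into [useq * a + qseq * b] cancels the terms in [m] and leaves
    [d (n_1 qseq - n_0 pseq)]. *)
Lemma construction_quotient r n rho delta m a b d : 0 < r ->
  construction r n rho delta m a b d -> coprime a b ->
  hj_quotient delta rho r a b d n.
Proof.
move=> r0 C cab; have [dE mE] := construction_hj r0 C.
have [cad _] := construction_coprime C cab.
have nE k := hj_rec_solution (construction_rec C) (k := k).
have ge2 := construction_ge2 C; case: C => rrho _ _ _ [aE bE].
split=> //.
  by exists (n 1)%:Z; rewrite -mE bE aE; ring.
split=> // k kr; rewrite /useq nE // -dE -mE bE aE; ring.
Qed.

Lemma qnum_construction r n rho delta m a b d : 0 < r ->
  construction r n rho delta m a b d -> qnum delta r = qseq delta r.+1.
Proof.
move=> r0 C; rewrite -{1}(prednK r0) qnum_hj prednK //.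
have ge2 := construction_ge2 C; case: C => rrho _ _ _ _ i /andP[i0 ir].
by apply: ge2; lia.
Qed.

(** The bound [qseq delta k < a] is not among the hypotheses, so irreducibility is drawn from the
    independence of [I] instead of [hj_quotient_irr]. *)
Lemma construction_Irr I r n rho delta m a b d :
  I `<=` ~` [set 0; 1] -> N_independent I -> mc_enumeration I r n ->
  construction r n rho delta m a b d -> admissible r delta a b d ->
  a < d < b /\ Irr (quotient_by (gen2 a b) d) = I.
Proof.
move=> I01 indep [r0 [nI _ nsurj] npos _ _] C [cab aq db].
have H := construction_quotient r0 C cab; rewrite (qnum_construction r0 C) in aq.
have [ge2 dE cad _ [rrho _]] := H; have [_ _ _ _ [aE _]] := C.
have I_ge2 x : I x -> 1 < x.
  by move=> /I01 /=; case: x => [|[|x]] // x01; exfalso; apply: x01; [left|right].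
have a1 : 1 < a by rewrite aE; apply: I_ge2; apply: nI.
split.
  rewrite db andbT ltn_neqAle; apply/andP; split.
    by apply/eqP => ad; move: cad; rewrite -ad /coprime gcdnn; lia.
  have := @qseq_mono _ _ r.+1 rho ge2; lia.
apply: Irr_of_independent => //.
- by move=> x Ix; have [k kr <-] := nsurj x Ix; apply: hj_quotient_mem H _.
- by move=> /I_ge2.
- move=> x Sx x0; have [//|k kr [y Sy xE]] := hj_quotient_step H _ aq Sx x0; first by lia.
  by exists (n k); [apply: nI|exists y].
Qed.

(** * Recovering a construction from a triplet *)

(** Euclidean algorithm with remainders by excess: [d = q m - m'] with [q] the ceiling of [d / m],
    and [q] is put in front of the expansion of [m / m']. *)
Lemma hj_expansion (d m : nat) : 0 < m < d -> coprime d m ->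
  exists delta i, [/\ ge2_upto delta i.+2,
    d%:Z = qseq delta i.+2 & m%:Z = pseq delta i.+2].
Proof.
elim/ltn_ind: m d => m IH d /andP[m0 md] cdm.
have [m1|m1] := leqP m 1.
  have -> : m = 1 by lia.
  exists (fun=> d%:Z), 0; split; first by move=> i _; lia.
    by rewrite /qseq /= mulr1 subr0.
  by rewrite /pseq /= mulr0 add0r opprK.
have dm : ~~ (m %| d).
  apply/negP => md'; move: cdm; rewrite /coprime gcdnC; move/gcdn_idPl: md' => ->; lia.
pose q := (d %/ m).+1; pose m' := q * m - d.
have [rm rm0] : d %% m < m /\ 0 < d %% m.
  by rewrite ltn_mod m0 lt0n; move: dm; rewrite /dvdn.
have dE := divn_eq d m.
have m'E : (m'%:Z = q%:Z * m%:Z - d%:Z)%R by rewrite /m' /q; lia.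
have m'm : 0 < m' < m by rewrite /m' /q; lia.
have cmm' : coprime m m'.
  move/coprime_Bezout: cdm => [u [v uv]]; apply/coprime_Bezout.
  by exists (v + u * q%:Z)%R, (- u)%R; rewrite m'E -uv; ring.
have [|delta [i [ge2 mE m'E']]] := IH m' _ m m'm cmm'; first by lia.
pose delta' k := if k is k'.+2 then delta k'.+1 else q%:Z.
have [qE pE] := hj_shift delta' i.+2.
have [|q1 p1] := @eq_hj (shift delta') delta i.+2 _ i.+2 (leqnn _).
  by case.
exists delta', i.+1; split.
- case=> [//|[|k]] ki /=; last by apply: ge2; lia.
  have : 0 < d %/ m by rewrite divn_gt0 // ltnW.
  by rewrite /q; lia.
- by rewrite qE q1 p1 -mE -m'E' /= m'E; ring.
- by rewrite pE q1.
Qed.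

(** The root is [- b / a] modulo [d], a unit because [b] is one. *)
Lemma exists_congruence_root (a b d : nat) : 1 < d -> coprime a d -> coprime b d ->
  exists m, [/\ 0 < m < d, coprime d m & d %| m * a + b].
Proof.
move=> d1 /coprime_Bezout[u [v uv]] cbd.
pose m := `|((- u * b%:Z) %% d%:Z)%Z|%N.
have d0 : (d%:Z != 0)%R by lia.
have mE : (m%:Z = ((- u * b%:Z) %% d%:Z)%Z)%R by rewrite gez0_abs // modz_ge0.
have [s sE] : exists s : int, (m%:Z * a%:Z + b%:Z = s * d%:Z)%R.
  have [w wE] : exists w : int, (- u * b%:Z = w * d%:Z + m%:Z)%R.
    by exists ((- u * b%:Z) %/ d%:Z)%Z; rewrite mE -divz_eq.
  exists (v * b%:Z - w * a%:Z)%R.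
  have -> : (m%:Z = - u * b%:Z - w * d%:Z)%R by rewrite wE; ring.
  by rewrite -[X in (_ + X)%R]mul1r -uv; ring.
move/coprime_Bezout: cbd => [x [y xy]].
have cdm : coprime d m.
  apply/coprime_Bezout; exists (y + x * s)%R, (- x * a%:Z)%R.
  have bE : (b%:Z = s * d%:Z - m%:Z * a%:Z)%R by rewrite -sE; ring.
  by rewrite -xy bE; ring.
exists m; split=> //.
  apply/andP; split.
    by rewrite lt0n; apply/eqP => m0; move: cdm; rewrite m0 /coprime gcdn0; lia.
  by rewrite -ltz_nat mE; apply: ltz_pmod; lia.
have : (d%:Z %| (m * a + b)%N%:Z)%Z by apply/dvdzP; exists s; rewrite -sE PoszD PoszM.
by rewrite /dvdz.
Qed.

Lemma qseq_bracket delta (a N : nat) : 0 < a -> (a%:Z <= qseq delta N)%R ->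
  exists2 R, R < N & (qseq delta R < a%:Z <= qseq delta R.+1)%R.
Proof.
move=> a0; elim: N => [|N IH] aN; first by move: aN; rewrite /qseq /=; lia.
have [aN'|aN'] := leP a%:Z%R (qseq delta N); last by exists N => //; rewrite aN' aN.
by have [R RN aR] := IH aN'; exists R => //; lia.
Qed.

Lemma eq_card_enum (I : set nat) r R (n n' : nat -> nat) :
  set_bij [set k | k <= r] I n -> set_bij [set k | k <= R] I n' -> R = r.
Proof.
move=> nb nb'.
have c : ([set k | k <= r] #= I)%card by apply/card_set_bijP; exists n.
have c' : ([set k | k <= R] #= I)%card by apply/card_set_bijP; exists n'.
have : (`I_R.+1 #= `I_r.+1)%card by apply: card_eq_trans c' _; rewrite card_eq_sym.
by move=> /card_eq_II[].
Qed.

(** The expansion of [d / m], where [d] divides [m a + b], supplies the coefficients. In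
    [qseq delta R < a <= qseq delta R.+1], the left bound makes [n' 0, ..., n' R] irreducible and
    the right one makes them generate. Counting [I] then gives [R = r]. *)
Lemma triplet_construction I r n a b d :
  mc_enumeration I r n -> triplet_for I a b d ->
  exists (n' : nat -> nat) (rho : nat) (delta : nat -> int) (m : nat),
    [/\ mc_enumeration I r n', construction r n' rho delta m a b d
      & admissible r delta a b d].
Proof.
move=> [r0 nbij npos _ _] [[a0 b0 d0] [cab cad cbd] IrrI /andP[ad db]].
have [|m [m0d cdm /dvdnP[s sE]]] := @exists_congruence_root a b d _ cad cbd; first by lia.
have [delta [i [ge2 dE mE]]] := hj_expansion m0d cdm.
pose rho := i.+2; rewrite -/rho in ge2 dE mE.
have [|R Rr /andP[qa aq]] := @qseq_bracket delta a rho a0; first by lia.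
(* The solution of the recurrence starting with [a] and [s = (m a + b) / d]. *)
pose n' k := `|(s%:Z * qseq delta k - a%:Z * pseq delta k)%R|%N.
have dn k : (d%:Z * (s%:Z * qseq delta k - a%:Z * pseq delta k) =
    useq delta rho k * a%:Z + qseq delta k * b%:Z)%R.
  have bE : (b%:Z = s%:Z * d%:Z - m%:Z * a%:Z)%R by lia.
  by rewrite /useq -mE -dE bE; ring.
have n'E k : k <= rho -> ((n' k)%:Z = s%:Z * qseq delta k - a%:Z * pseq delta k)%R.
  move=> kr; rewrite gez0_abs // -(@pmulr_rge0 _ d%:Z) // dn.
  have q0 : (0 <= qseq delta k)%R by apply: (@qseq_mono _ _ 0 k ge2).
  by have u0 := useq_ge0 ge2 kr; rewrite addr_ge0 ?mulr_ge0.
have H : hj_quotient delta rho R a b d n'.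
  split=> //; first by exists s%:Z; rewrite -mE; lia.
  by split=> // k kR; rewrite n'E; [exact: dn|lia].
have n'irr k : k <= R -> I (n' k).
  move=> kR; rewrite -IrrI; apply: (hj_quotient_irr H) => //.
  by apply: le_lt_trans qa; apply: (qseq_mono ge2); lia.
(* The unique representation of [n' k] recovers [qseq delta k], which is strictly increasing in
   [k]. *)
have n'inj j k : j <= k -> k <= R -> n' j = n' k -> j = k.
  move=> jk kR E; have [u [v uv]] := hj_quotient_mem H (leq_trans jk kR).
  have qlt l : l <= R -> (qseq delta l < a%:Z)%R.
    by move=> lR; apply: le_lt_trans qa; apply: (qseq_mono ge2); lia.
  have [_ vj] := hj_quotient_unique H cab db (leq_trans jk kR) (qlt _ (leq_trans jk kR)) uv.
  rewrite E in uv; have [_ vk] := hj_quotient_unique H cab db kR (qlt _ kR) uv.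
  move: jk; rewrite leq_eqVlt => /orP[/eqP//|jk].
  by have := @qseq_ltn _ _ j k ge2; lia.
have n'bij : set_bij [set k | k <= R] I n'.
  split=> [k /n'irr//|j k|x].
    rewrite !inE /= => jR kR E; have [jk|kj] := leqP j k; first exact: n'inj.
    by apply/esym/n'inj => //; exact: ltnW.
  rewrite -IrrI => -[Sx x0 xirr].
  have [k kR [y Sy xE]] := hj_quotient_step H a0 aq Sx x0.
  exists k => //; have := hj_quotient_gen_gt0 H a0 b0 kR.
  by case: (xirr _ _ (hj_quotient_mem H kR) Sy xE); lia.
have ER := eq_card_enum nbij n'bij; rewrite {R}ER in Rr qa aq H n'irr n'inj n'bij.
have n'0 : n' 0 = a by rewrite /n' /qseq /pseq /=; lia.
have n'1 : n' 1 = s by rewrite /n' /qseq /pseq /=; lia.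
have n'rec k : 0 < k < r ->
    ((n' k.+1)%:Z = delta k * (n' k)%:Z - (n' k.-1)%:Z)%R.
  case: k => [//|k] /andP[_ kr] /=.
  by rewrite !n'E ?qseqSS ?pseqSS; [ring|lia..].
have C : construction r n' rho delta m a b d.
  split=> //.
  - by move=> k kr; split; [apply: ge2; lia|exact: n'rec].
  - by move=> k kr; apply: ge2; lia.
  - by split=> //; [lia|apply/ceilfrac_hjP => //; lia].
  - by rewrite n'0 n'1; split=> //; lia.
exists n', rho, delta, m; split=> //.
  split=> //.
  - by move=> k kr; apply: (hj_quotient_gen_gt0 H).
  - move=> k kr; exists (delta k - 2)%R; first by have := ge2 k; lia.
    by rewrite n'rec //; ring.
  - rewrite n'0 n'1; move/coprime_Bezout: cab => [u [v uv]]; apply/coprime_Bezout.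
    exists (u - v * m%:Z)%R, (v * d%:Z)%R; rewrite -uv.
    have bE : (b%:Z = s%:Z * d%:Z - m%:Z * a%:Z)%R by lia.
    by rewrite bE; ring.
by split=> //; rewrite (qnum_construction r0 C).
Qed.

(** * Infinitely many triplets with one free coefficient *)

(* Otherwise (q_r - n_r, n_0) lies in the monoid spanned by the vectors
   (useq k, qseq k), does not dominate (useq 0, qseq 0) = (q_r, 0), and has the
   same image n_0, so that n_0 is a combination of n_1, ..., n_r. *)
Lemma qseq_lt_last (I : set nat) r n delta :
  N_independent I -> mc_enumeration I r n -> ge2_upto delta r ->
  hj_rec delta r (fun k => (n k)%:Z) -> (qseq delta r < (n r)%:Z)%R.
Proof.
move=> indep [r0 [nI ninj _] npos _ _] ge2 nrec; rewrite ltNge; apply/negP => nq.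
have nE k := hj_rec_solution nrec (k := k).
have qr0 : (0 < qseq delta r)%R by have := @qseq_gt0 _ _ r.-1 ge2; rewrite prednK //; apply.
have qn k : k <= r -> (qseq delta r * (n k)%:Z =
    useq delta r k * (n 0)%:Z + qseq delta k * (n r)%:Z)%R.
  by move=> kr; rewrite /useq (nE k kr) (nE r (leqnn r)); ring.
have gen (v u x : nat) (t : int) : (u%:Z < qseq delta r)%R ->
    (u%:Z = pseq delta r * v%:Z - t * qseq delta r)%R ->
    (qseq delta r * x%:Z = u%:Z * (n 0)%:Z + v%:Z * (n r)%:Z)%R ->
    smallest submonoid (I `\ n 0) x.
  elim/ltn_ind: v u x t => v IH u x t uq uE xE M HM; have [[M0 MD] IM] := HM.
  have [uv|uv0] := ltP (0 : int)%R (u%:Z + v%:Z)%R; last first.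
    have [uz vz] : u = 0 /\ v = 0 by lia.
    by rewrite uz vz in xE; have -> : x = 0 by nia.
  have [//|//|k kr [ku kv _]] := lattice_step ge2 _ _ uv uE.
  have k0 : 0 < k.
    by rewrite lt0n; apply/eqP => k0; move: ku; rewrite k0 useq0; lia.
  have qk := @qseq_gt0 _ _ k.-1 ge2; rewrite prednK // in qk.
  have {}qk := qk kr.
  have uk := useq_ge0 ge2 kr.
  have nx : n k <= x.
    rewrite -lez_nat -(ler_pM2l qr0) qn // xE.
    by apply: lerD; apply: ler_wpM2r.
  rewrite -(subnKC nx); apply: MD.
    apply: IM; split; first exact: nI.
    by move=> /= nk; have := ninj k 0; rewrite !inE /= => /(_ kr isT nk); lia.
  apply: (IH `|(v%:Z - qseq delta k)%R|%N _ `|(u%:Z - useq delta r k)%R|%N _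
    (t - pseq delta k)%R _ _ _ M HM).
  - by lia.
  - by lia.
  - by rewrite !gez0_abs ?subr_ge0 // uE /useq; ring.
  - by rewrite !gez0_abs ?subr_ge0 // -subzn // mulrBr qn // xE; ring.
have n0r := npos r (leqnn r).
apply: (indep (n 0)); first by apply: nI.
(* [n_r = n_1 qseq - n_0 pseq] at index [r], so the first entry [qseq - n_r] equals
   [n_0 pseq - (n_1 - 1) qseq]. *)
apply: (gen (n 0) `|(qseq delta r - (n r)%:Z)%R|%N (n 0) ((n 1)%:Z - 1)%R).
- by lia.
- by rewrite gez0_abs ?subr_ge0 // (nE r (leqnn r)); ring.
- by rewrite gez0_abs ?subr_ge0 //; ring.
Qed.

(* c is divisible by exactly those primes p | N that do not divide y, so that each
   p | N divides exactly one of (c + t N) x and y. *)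
Lemma coprime_affine (N x y : nat) : 0 < N -> 0 < y -> coprime x y ->
  exists c, forall t, y < (c + t * N) * x -> coprime N ((c + t * N) * x - y).
Proof.
move=> N0 y0 cxy; pose c := N`_(\pi(y)^'); exists c => t yx.
set D := c + t * N in yx *.
have dvdD p : p %| N -> (p %| D) = (p %| c).
  by move=> pN; rewrite /D dvdn_addl // dvdn_mull.
have dvdc p : prime p -> p %| N -> (p %| c) = ~~ (p %| y).
  move=> pp pN; have : (p \in primes c) = (p \in \pi(y)^') && (p \in primes N).
    by rewrite primes_part mem_filter.
  by rewrite inE /= !mem_primes pp part_gt0 N0 y0 pN /= !andbT.
rewrite coprime_has_primes ?subn_gt0 //; apply/hasPn => p.
rewrite !mem_primes => /and3P[pp _ pDx]; apply/negP => /and3P[_ _ pN].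
have pyDx : (p %| y) = (p %| D * x) by rewrite -(subnK (ltnW yx)) dvdn_addr.
have [py|py] := boolP (p %| y); last first.
  have pD : p %| D by rewrite dvdD // dvdc.
  by move: py; rewrite pyDx dvdn_mulr.
move: (py); rewrite pyDx Euclid_dvdM // dvdD // dvdc // py /= => px.
have : p %| gcdn x y by rewrite dvdn_gcd px.
by move/eqP: cxy => ->; rewrite Euclid_dvd1.
Qed.

Lemma hj_rec_coprime r (n : nat -> nat) delta k : hj_rec delta r (fun k => (n k)%:Z) ->
  coprime (n 0) (n 1) -> k < r -> coprime (n k) (n k.+1).
Proof.
move=> nrec c01; elim: k => [//|k IH] kr.
have /coprime_Bezout[u [v uv]] := IH (ltnW kr); apply/coprime_Bezout.
by exists (v + u * delta k.+1)%R, (- u)%R; rewrite nrec // -uv; ring.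
Qed.

(** Below [r] the division is exact by modular convexity; [D] at index [r] is the one free
    coefficient when [rho = r + 1]. *)
Definition mc_coefs (r : nat) (n : nat -> nat) (D i : nat) : int :=
  if i < r then ((n i.-1 + n i.+1) %/ n i)%:Z else D%:Z.

Lemma mc_coefsP r n D i : (forall k, k <= r -> 0 < n k) -> modular_convex r n ->
  0 < i < r -> (2 <= mc_coefs r n D i)%R /\
    ((n i.+1)%:Z = mc_coefs r n D i * (n i)%:Z - (n i.-1)%:Z)%R.
Proof.
move=> npos conv ir; have [c c0 cE] := conv i ir; rewrite /mc_coefs.
have -> : i < r by lia.
have ni : 0 < n i by apply: npos; lia.
have E : n i.-1 + n i.+1 = (`|c|%N + 2) * n i by nia.
by rewrite E mulnK //; split; nia.
Qed.

(** For [rho = r + 1], [b = d n_1 - m n_0] is the next term [D n_r - n_(r-1)] of the sequence, while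
    [d] is [D qseq - qseq'] with [qseq, qseq'] at [r, r - 1]. As [qseq < n_r], [d < b] follows from
    [D > n_(r-1)]. *)
Lemma mc_coefs_construction I r n D :
  N_independent I -> mc_enumeration I r n -> 1 < D -> n 0 <= D -> n r.-1 < D ->
  coprime (n 0) (D * n r - n r.-1) ->
  exists d m, construction r n r.+1 (mc_coefs r n D) m (n 0) (D * n r - n r.-1) d
    /\ admissible r (mc_coefs r n D) (n 0) (D * n r - n r.-1) d.
Proof.
move=> indep enum D1 nD nrD cop; have [r0 _ npos conv _] := enum.
set delta := mc_coefs r n D; set b := D * n r - n r.-1.
have dP i := @mc_coefsP r n D i npos conv.
have ge2 : ge2_upto delta r.+1.
  move=> i ir; have [ir'|ri] := ltnP i r; first by case: (dP i) => //; lia.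
  by rewrite /delta /mc_coefs ltnNge ri /=; lia.
have ge2r : ge2_upto delta r by move=> i ir; apply: ge2; lia.
have nrec : hj_rec delta r (fun k => (n k)%:Z).
  by move=> k kr; have [] := dP k.+1; rewrite ?kr.
have qn := qseq_lt_last indep enum ge2r nrec.
have dr : delta r = D%:Z by rewrite /delta /mc_coefs ltnn.
have qS : (qseq delta r.+1 = D%:Z * qseq delta r - qseq delta r.-1)%R.
  by rewrite -dr -(prednK r0) qseqSS prednK.
have pS : (pseq delta r.+1 = D%:Z * pseq delta r - pseq delta r.-1)%R.
  by rewrite -dr -(prednK r0) pseqSS prednK.
have /andP[q0 q1] := @qseq_incr delta r.+1 r.-1 ge2 (leq_pred r).
rewrite prednK // in q1.
have nr := npos r (leqnn r).
have bE : (b%:Z = D%:Z * (n r)%:Z - (n r.-1)%:Z)%R by rewrite /b; nia.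
pose d := `|qseq delta r.+1|%N; pose m := `|pseq delta r.+1|%N.
have dE : (d%:Z = qseq delta r.+1)%R by rewrite /d; nia.
have p0 : (0 < pseq delta r.+1)%R.
  by rewrite -(prednK r0); apply: pseq_gt0; rewrite prednK.
have mE : (m%:Z = pseq delta r.+1)%R by rewrite /m; lia.
have cdm : coprime d m by exact: coprime_hj.
have C : construction r n r.+1 delta m (n 0) b d.
  split=> //.
  - by move=> i ir; apply: ge2; lia.
  - split=> //; [by nia|by lia|].
    have cfP := @ceilfrac_hjP delta r.-1 d m; rewrite prednK // in cfP.
    by apply/cfP => //; lia.
  - split=> //; rewrite bE dE mE qS pS.
    rewrite (hj_rec_solution nrec (leqnn r)) (hj_rec_solution nrec (leq_pred r)); ring.
exists d, m; split=> //; split=> //; first by rewrite (qnum_construction r0 C); nia.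
by rewrite -ltz_nat bE dE qS; nia.
Qed.

Lemma infinite_construction I r n :
  I `<=` ~` [set 0; 1] -> N_independent I -> mc_enumeration I r n ->
  infinite_set [set t : nat * nat * nat |
    let: (a, b, d) := t in
    triplet_for I a b d /\
    exists (delta : nat -> int) (m : nat),
      construction r n r.+1 delta m a b d /\ admissible r delta a b d].
Proof.
move=> I01 indep enum; have [r0 _ npos conv c01] := enum.
have nrec : hj_rec (mc_coefs r n 2) r (fun k => (n k)%:Z).
  by move=> k kr; have [] := @mc_coefsP r n 2 k.+1 npos conv; rewrite ?kr.
have n0 := npos 0 (leq0n r); have nr := npos r (leqnn r); have nr' := npos r.-1 (leq_pred r).
have cop := @hj_rec_coprime r n _ r.-1 nrec c01; rewrite prednK // in cop.
have [|c cP] := coprime_affine n0 nr' (x := n r); first by rewrite coprime_sym cop.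
(* The class of [c] modulo [n 0] ensures coprimality, the summand [n r.-1 + 2] the size bounds, and
   varying [t] gives distinct [b]. *)
pose D t := c + (t + n r.-1 + 2) * n 0.
have DP t : [/\ 1 < D t, n 0 <= D t & n r.-1 < D t] by rewrite /D; split; nia.
have yx t : n r.-1 < D t * n r.
  by have [_ _ h] := DP t; apply: leq_trans h _; rewrite leq_pmulr.
have dP t : exists d : nat, triplet_for I (n 0) (D t * n r - n r.-1) d /\
    exists (delta : nat -> int) (m : nat),
      construction r n r.+1 delta m (n 0) (D t * n r - n r.-1) d /\
      admissible r delta (n 0) (D t * n r - n r.-1) d.
  have [D1 nD nrD] := DP t.
  have [d [m [C A]]] := mc_coefs_construction indep enum D1 nD nrD (cP _ (yx t)).
  exists d; split; last by exists (mc_coefs r n (D t)), m.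
  have [cab _ db] := A; have [cad cbd] := construction_coprime C cab.
  have [adb IrrE] := construction_Irr I01 indep enum C A.
  by split=> //; split=> //; lia.
have [d {}dP] := choice dP.
set A := (X in infinite_set X).
pose f t := (n 0, D t * n r - n r.-1, d t).
move=> finA; apply: infinite_nat.
have -> : [set: nat] = f @^-1` A by apply/seteqP; split=> // t _; exact: dP.
apply: finite_preimage => // s t _ _ [E _].
by have := yx s; have := yx t; move: E; rewrite /D; nia.
Qed.

Theorem theorem2 (I : set nat) (r : nat) (n : nat -> nat)
    (finI : finite_set I)
    (I_sub : I `<=` ~` [set 0; 1])
    (indepI : N_independent I)
    (enumI : mc_enumeration I r n) :
  [/\ forall (rho : nat) (delta : nat -> int) (m a b d : nat),
        construction r n rho delta m a b d ->
        admissible r delta a b d ->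
        a < d < b /\ Irr (quotient_by (gen2 a b) d) = I,
      forall a b d : nat,
        triplet_for I a b d ->
        exists (n' : nat -> nat) (rho : nat) (delta : nat -> int) (m : nat),
          [/\ mc_enumeration I r n',
              construction r n' rho delta m a b d
            & admissible r delta a b d]
    & infinite_set [set t : nat * nat * nat |
        let: (a, b, d) := t in
        triplet_for I a b d /\
        exists (delta : nat -> int) (m : nat),
          construction r n r.+1 delta m a b d /\
          admissible r delta a b d]].
Proof.
split.
- by move=> rho delta m a b d; exact: construction_Irr.
- by move=> a b d; exact: (triplet_construction enumI).
- exact: infinite_construction.
Qed.
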